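(* For every $m\ge4$ and every $\beta>0$, the e-ADMM is not necessarily convergent when $(m-3)$ of the functions in the objective are strongly convex: there exist an instance of problem (P) with $m$ blocks in which exactly $m-3$ of the functions $\theta_1,\dots,\theta_m$ are strongly convex, and an initial point $(x_2^0,\dots,x_m^0,z^0)$, such that the sequence generated by the e-ADMM with penalty parameter $\beta$ does not converge.
   Context: Problem (P): minimize $\sum_{i=1}^m\theta_i(x_i)$ subject to $\sum_{i=1}^m A_ix_i=b$, $x_i\in\mathcal X_i$ ($i=1,\dots,m$), where $\theta_i:\mathbb R^{n_i}\to\mathbb R$ are closed proper convex functions, $A_i\in\mathbb R^{l\times n_i}$, $\mathcal X_i\subseteq\mathbb R^{n_i}$ are nonempty closed convex sets, $b\in\mathbb R^l$, and the solution set is nonempty. A function $f$ is strongly convex if for some $\mu>0$, $f(tx+(1-t)y)\le tf(x)+(1-t)f(y)-\frac{\mu}{2}t(1-t)\|x-y\|^2$ for all $x,y$ and $t\in[0,1]$. Augmented Lagrangian ($\beta>0$): $\mathcal L_\beta(x_1,\dots,x_m,z)=\sum_i\theta_i(x_i)-z^\top(\sum_iA_ix_i-b)+\frac{\beta}{2}\|\sum_iA_ix_i-b\|^2$, $z\in\mathbb R^l$. e-ADMM: from an initial $(x_2^0,\dots,x_m^0,z^0)$, for $k=0,1,2,\dots$ compute successively for $i=1,\dots,m$ $x_i^{k+1}=\arg\min\{\mathcal L_\beta(x_1^{k+1},\dots,x_{i-1}^{k+1},x_i,x_{i+1}^k,\dots,x_m^k,z^k): x_i\in\mathcal X_i\}$,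 and then $z^{k+1}=z^k-\beta(\sum_{i=1}^mA_ix_i^{k+1}-b)$. The generated sequence is $w^k=(x_1^k,\dots,x_m^k,z^k)$, $k\ge1$. *)

(* Defs.v *)
From HB Require Import structures.
From mathcomp Require Import all_boot all_order all_algebra.
From mathcomp Require Import all_classical all_reals all_analysis.

Set Implicit Arguments.
Unset Strict Implicit.
Unset Printing Implicit Defensive.

Import Order.TTheory GRing.Theory Num.Theory.
Import numFieldNormedType.Exports.

Local Open Scope classical_set_scope.
Local Open Scope ring_scope.

Definition dotv (R : realType) (n : nat) (u v : 'cV[R]_n) : R :=
  \sum_i u i 0 * v i 0.

(* The library norm on matrices is the sup norm, hence this definition. *)
Definition enorm (R : realType) (n : nat) (v : 'cV[R]_n) : R :=
  Num.sqrt (dotv v v).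

Definition argmin (R : realType) (T : Type) (D : set T) (f : T -> R) : set T :=
  [set u | D u /\ forall v, D v -> f u <= f v].

Definition proper (R : realType) (T : Type) (f : T -> \bar R) : Prop :=
  (forall x, f x != -oo%E) /\ (exists x, (f x < +oo)%E).

(* For a proper convex function, closed means lower semicontinuous. *)
Definition closed_proper_convex (R : realType) (n : nat)
    (f : 'cV[R]_n -> R) : Prop :=
  [/\ lower_semicontinuous (EFin \o f),
      proper (EFin \o f) &
      convex_function (E := 'cV[R]_n) setT f].

Definition strongly_convex (R : realType) (n : nat)
    (f : 'cV[R]_n -> R) : Prop :=
  exists2 mu : R, 0 < mu &
    forall (x y : 'cV[R]_n) (t : R), 0 <= t <= 1 ->
      f (t *: x + (1 - t) *: y) <=
        t * f x + (1 - t) * f y - mu / 2 * t * (1 - t) * enorm (x - y) ^+ 2.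

(* Blocks are numbered from 0, so the block x_1 has index 0. *)
Record problem (R : realType) (m : nat) := Problem {
  dim : 'I_m -> nat;
  nrows : nat;
  theta : forall i, 'cV[R]_(dim i) -> R;
  coefA : forall i, 'M[R]_(nrows, dim i);
  setX : forall i, set 'cV[R]_(dim i);
  rhs : 'cV[R]_nrows }.

Section Problem.
Variables (R : realType) (m : nat) (P : problem R m).

Definition primal : Type := forall i, 'cV[R]_(dim P i).
Definition multiplier : Type := 'cV[R]_(nrows P).

Definition objective (x : primal) : R := \sum_i theta (x i).

Definition residual (x : primal) : 'cV[R]_(nrows P) :=
  \sum_i coefA P i *m x i - rhs P.

Definition feasible : set primal :=
  [set x | residual x = 0 /\ forall i, setX (x i)].

Definition solutions : set primal := argmin feasible objective.

Definition admissible : Prop :=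
  [/\ (0 < nrows P)%N /\ (forall i, 0 < dim P i)%N,
      forall i, closed_proper_convex (@theta R m P i),
      forall i, [/\ @setX R m P i !=set0, closed (@setX R m P i) &
                    convex_set (M := 'cV[R]_(dim P i)) (@setX R m P i)] &
      solutions !=set0].

Definition aug_lagrangian (beta : R) (x : primal) (z : multiplier) : R :=
  objective x - dotv z (residual x) + beta / 2 * enorm (residual x) ^+ 2.

(* The point (xnew_1, .., xnew_(i-1), u, xold_(i+1), .., xold_m). *)
Definition gauss_seidel (xnew xold : primal) (i : 'I_m)
    (u : 'cV[R]_(dim P i)) : primal :=
  eqtype.dfwith (fun j : 'I_m => if (j < i)%N then xnew j else xold j) u.

(* Each iterate is required to be the unique minimizer of its subproblem, so
   that the sequence is determined by the initial point; with an arbitrary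
   selection of minimizers, non-convergence could come from the selection alone.
   The first block of x0 (and of x 0) plays no role. *)
Definition eADMM (beta : R) (x0 : primal) (z0 : multiplier)
    (x : nat -> primal) (z : nat -> multiplier) : Prop :=
  [/\ forall i : 'I_m, (0 < i)%N -> x 0%N i = x0 i,
      z 0%N = z0,
      forall k (i : 'I_m),
        argmin (@setX R m P i)
          (fun u => aug_lagrangian beta (gauss_seidel (x k.+1) (x k) u) (z k))
        = [set x k.+1 i] &
      forall k, z k.+1 = z k - beta *: residual (x k.+1)].

(* The sequence w^k = (x_1^k, .., x_m^k, z^k), k >= 1, as stacked vectors. *)
Definition iterates (x : nat -> primal) (z : nat -> multiplier) (k : nat) :
    'cV[R]_(\sum_i dim P i + nrows P) :=
  col_mx (\mxcol_i x k.+1 i) (z k.+1).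

End Problem.

(* Main.v *)
Require Import Defs.
From mathcomp Require Import all_boot all_order all_algebra.
From mathcomp Require Import all_classical all_reals all_analysis.
From mathcomp Require Import ring lra.

(** The construction.  Take three scalar blocks with zero objective, coupled in
    R^3 by the columns (0,1,3), (1,0,3), (1,1,2) and right-hand side 0, and give
    every further block the objective v^2 and a zero coefficient matrix.  The
    further blocks are then uncoupled: they are at their minimizer 0 from the
    start, and they supply exactly the m - 3 strongly convex functions.

    Each sweep acts linearly on the three coupled blocks and the multiplier.
    Write D, L, U for the diagonal and the strict triangles of the Gram
    matrix of the columns a_1, a_2, a_3.  Eliminating the multiplier from the
    eigenvalue equations leaves
      det (l^2 (D + L) + (2 l - 1) U) = 0,
    that is, with normalized Gram entries g_ij, p = g_12 g_13 g_23 and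
    q = g_12^2 + g_13^2 + g_23^2 - p,
      l^2 (l^4 - q l^2 (2 l - 1) + p (2 l - 1)^2) = 0.
    The three columns are chosen so that the quartic has the rational factor
      l^2 - (37/20) l + 21/20,
    whose roots are complex conjugate of modulus sqrt (21/20) > 1.  The real
    invariant plane that belongs to this pair has rational coordinates, so that
    a whole orbit of the method can be written down from the single scalar
    recurrence u_(k+2) = (37/20) u_(k+1) - (21/20) u_k ([spiral]).  The penalty
    parameter only rescales the multiplier.

    That this orbit is generated by the method comes from expanding the
    augmented Lagrangian to second order in one block
    ([aug_lagrangian_expansion]).  For the three coupled blocks the linear term
    vanishes, which is an identity in u_k and u_(k+1), and the quadratic term is
    positive because the columns are nonzero, so that each block is the unique
    minimizer of its subproblem ([argmin_block], [eADMM_spiral]).  The orbit does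
    not converge because a positive definite quadratic form grows along it by
    the factor 21/20 at each step, whereas the only possible limit of u is 0
    ([spiral_not_cvg]). *)

Set Implicit Arguments.
Unset Strict Implicit.
Unset Printing Implicit Defensive.

Import Order.TTheory GRing.Theory Num.Theory.
Import numFieldNormedType.Exports.

Local Open Scope classical_set_scope.
Local Open Scope ring_scope.

(** * Euclidean norm, convexity and semicontinuity *)

Lemma enorm_sqr (R : realType) (n : nat) (v : 'cV[R]_n) :
  enorm v ^+ 2 = dotv v v.
Proof.
by rewrite /enorm sqr_sqrtr// /dotv sumr_ge0// => i _; rewrite -expr2 sqr_ge0.
Qed.

Lemma dotvDr (R : realType) (n : nat) (u v w : 'cV[R]_n) :
  dotv u (v + w) = dotv u v + dotv u w.
Proof.
by rewrite /dotv -big_split; apply: eq_bigr => i _; rewrite mxE mulrDr.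
Qed.

Lemma dotvC (R : realType) (n : nat) (u v : 'cV[R]_n) : dotv u v = dotv v u.
Proof. by apply: eq_bigr => i _; rewrite mulrC. Qed.

Lemma dotvBl (R : realType) (n : nat) (u v w : 'cV[R]_n) :
  dotv (u - v) w = dotv u w - dotv v w.
Proof.
by rewrite /dotv -sumrB; apply: eq_bigr => i _; rewrite !mxE mulrBl.
Qed.

Lemma dotvZl (R : realType) (n : nat) (a : R) (u v : 'cV[R]_n) :
  dotv (a *: u) v = a * dotv u v.
Proof.
by rewrite /dotv mulr_sumr; apply: eq_bigr => i _; rewrite mxE mulrA.
Qed.

Lemma continuous_lower_semicontinuous (R : realType) (X : topologicalType)
    (f : X -> R) : continuous f -> lower_semicontinuous (EFin \o f).
Proof.
move=> cf x a /=; rewrite lte_fin => afx.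
exists [set y | a < f y]; last by move=> y; rewrite lte_fin.
exact: (cvgr_gt _ (cf x)).
Qed.

Lemma closed_proper_convex_continuous (R : realType) (n : nat)
    (f : 'cV[R]_n -> R) :
  continuous f ->
  (forall (t : R) (x y : 'cV[R]_n), 0 <= t <= 1 ->
     f (t *: x + (1 - t) *: y) <= t * f x + (1 - t) * f y) ->
  closed_proper_convex f.
Proof.
move=> cf convf; split; first exact: continuous_lower_semicontinuous.
  by split=> [x //|]; exists 0; rewrite /= ltry.
by move=> t x y _ _; apply: convf; rewrite ge0 le1.
Qed.

Lemma closed_proper_convex_zero (R : realType) (n : nat) :
  closed_proper_convex (fun _ : 'cV[R]_n => 0).
Proof.
apply: closed_proper_convex_continuous => [|t x y _];
  last by rewrite !mulr0 addr0.
exact: cst_continuous.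
Qed.

Lemma closed_proper_convex_square (R : realType) :
  closed_proper_convex (fun v : 'cV[R]_1 => v 0 0 ^+ 2).
Proof.
apply: closed_proper_convex_continuous => [x|t x y /andP[t0 t1]].
  rewrite /= (_ : (fun v : 'cV[R]_1 => _) = fun v => v 0 0 * v 0 0); last first.
    by apply/funext => v; rewrite expr2.
  by apply: (@continuousM R _ (fun v : 'cV[R]_1 => v 0 0) (fun v => v 0 0));
    apply: coord_continuous.
rewrite !mxE -subr_ge0.
have -> : t * x 0 0 ^+ 2 + (1 - t) * y 0 0 ^+ 2
   - (t * x 0 0 + (1 - t) * y 0 0) ^+ 2
   = t * (1 - t) * (x 0 0 - y 0 0) ^+ 2 by ring.
by rewrite mulr_ge0 ?sqr_ge0// mulr_ge0 ?subr_ge0.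
Qed.

Lemma strongly_convex_square (R : realType) :
  strongly_convex (fun v : 'cV[R]_1 => v 0 0 ^+ 2).
Proof.
exists 2 => // x y t _.
rewrite enorm_sqr /dotv big_ord1 !mxE.
by rewrite le_eqVlt; apply/orP; left; apply/eqP; field.
Qed.

Lemma not_strongly_convex_zero (R : realType) (n : nat) :
  ~ strongly_convex (fun _ : 'cV[R]_n.+1 => 0).
Proof.
move=> [mu mu0 /(_ (const_mx 1) 0 (1 / 2))].
have -> : (0 <= 1 / 2 :> R) && (1 / 2 <= 1 :> R) by apply/andP; split; lra.
move=> /(_ isT); rewrite subr0 enorm_sqr.
have : 0 < dotv (const_mx 1 : 'cV[R]_n.+1) (const_mx 1).
  rewrite /dotv (eq_bigr (fun=> 1)); last by move=> i _; rewrite mxE mulr1.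
  by rewrite sumr_const card_ord ltr0n.
set d := dotv _ _ => d0.
have : 0 < mu * d by rewrite mulr_gt0.
lra.
Qed.

(** * One block of the augmented Lagrangian *)

Section Block.
Variables (R : realType) (m : nat) (P : problem R m).
Implicit Types (xn xo : primal P) (z : multiplier P).

Lemma objective_gauss_seidel xn xo (i : 'I_m) (u v : 'cV[R]_(Defs.dim P i)) :
  objective (gauss_seidel xn xo u) - objective (gauss_seidel xn xo v)
  = theta u - theta v.
Proof.
rewrite /objective (bigD1 i)//= [in X in _ - X](bigD1 i)//=.
rewrite /gauss_seidel !dfwith_in.
under eq_bigr => j ji do rewrite dfwith_out 1?eq_sym//.
under [in X in _ - X]eq_bigr => j ji do rewrite dfwith_out 1?eq_sym//.
by rewrite opprD addrACA subrr addr0.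
Qed.

Lemma residual_gauss_seidel xn xo (i : 'I_m) (u v : 'cV[R]_(Defs.dim P i)) :
  residual (gauss_seidel xn xo u)
  = residual (gauss_seidel xn xo v) + coefA P i *m (u - v).
Proof.
rewrite /residual (bigD1 i)//= [in X in _ = X - _ + _](bigD1 i)//=.
rewrite /gauss_seidel !dfwith_in.
under eq_bigr => j ji do rewrite dfwith_out 1?eq_sym//.
under [in X in _ = X - _ + _]eq_bigr => j ji do rewrite dfwith_out 1?eq_sym//.
by rewrite mulmxBr [RHS]addrC -!addrA addKr.
Qed.

(** The coupling part of the augmented Lagrangian is quadratic, so that its
    second-order expansion in one block is exact. *)
Lemma aug_lagrangian_expansion beta xn xo z (i : 'I_m)
    (u v : 'cV[R]_(Defs.dim P i)) :
  aug_lagrangian beta (gauss_seidel xn xo u) z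
  = aug_lagrangian beta (gauss_seidel xn xo v) z + (theta u - theta v)
    + dotv (beta *: residual (gauss_seidel xn xo v) - z) (coefA P i *m (u - v))
    + beta / 2 * enorm (coefA P i *m (u - v)) ^+ 2.
Proof.
rewrite /aug_lagrangian -(objective_gauss_seidel xn xo u v).
rewrite (residual_gauss_seidel xn xo u v) !enorm_sqr.
move: (residual _) (_ *m _) => r d.
rewrite dotvBl dotvZl !dotvDr (dotvC (r + d)) (dotvC (r + d)) !dotvDr (dotvC d r).
by field.
Qed.

(** Reduces optimality of a block to the increment given by the expansion.  In
    the orbit below the linear terms of this increment cancel, by the
    first-order condition at [v], and a positive multiple of a square remains. *)
Lemma argmin_block beta xn xo z (i : 'I_m) (v : 'cV[R]_(Defs.dim P i)) :
  @Defs.setX R m P i = setT ->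
  (forall u, u != v ->
     0 < theta u - theta v
       + dotv (beta *: residual (gauss_seidel xn xo v) - z) (coefA P i *m (u - v))
       + beta / 2 * enorm (coefA P i *m (u - v)) ^+ 2) ->
  argmin (@Defs.setX R m P i)
    (fun u => aug_lagrangian beta (gauss_seidel xn xo u) z) = [set v].
Proof.
move=> XT grow.
have growL u : u != v -> aug_lagrangian beta (gauss_seidel xn xo v) z
                       < aug_lagrangian beta (gauss_seidel xn xo u) z.
  move=> /grow; rewrite (aug_lagrangian_expansion beta xn xo z u v); lra.
rewrite /argmin XT; apply/seteqP; split=> u /=.
  move=> [_ /(_ v Logic.I)]; have [//|/growL] := eqVneq u v.
  by rewrite ltNge => /negP.
by move=> ->; split=> // w _; have [->//|/growL/ltW] := eqVneq w v.
Qed.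

End Block.

(** * The divergent scalar recurrence *)

Section Spiral.
Variable R : realType.

Fixpoint spiral_state (k : nat) : R * R :=
  if k is k'.+1 then
    let s := spiral_state k' in (s.2, 37 / 20 * s.2 - 21 / 20 * s.1)
  else (0, 1).

Definition spiral (k : nat) : R := (spiral_state k).1.

Lemma spiralSS k : spiral k.+2 = 37 / 20 * spiral k.+1 - 21 / 20 * spiral k.
Proof. by []. Qed.

Definition spiral_norm (a b : R) : R :=
  b ^+ 2 - 37 / 20 * a * b + 21 / 20 * a ^+ 2.

(** This is the field norm of b - l a, for l a root of the characteristic
    polynomial; passing from k to k + 1 multiplies this element by the other
    root, hence its norm by the product 21/20 of the roots. *)
Lemma spiral_norm_ge1 k : 1 <= spiral_norm (spiral k) (spiral k.+1).
Proof.
elim: k => [|k IH]; first by rewrite /spiral_norm /spiral /=; lra.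
have -> : spiral_norm (spiral k.+1) (spiral k.+2)
          = 21 / 20 * spiral_norm (spiral k) (spiral k.+1).
  by rewrite spiralSS /spiral_norm; field.
lra.
Qed.

(** A limit would be a fixed point of the recurrence, hence 0 since 1 is not a
    root of the characteristic polynomial; the quadratic form would then tend
    to 0. *)
Lemma spiral_not_cvg : ~ cvgn spiral.
Proof.
move=> /cvg_ex[/= l ul].
have uSl : (fun k => spiral k.+1) @ \oo --> l by rewrite cvg_shiftS.
have uSSl : (fun k => spiral k.+2) @ \oo --> l.
  by rewrite (cvg_shiftS (fun k => spiral k.+1)).
have l0 : l = 0.
  have : (fun k => spiral k.+2) @ \oo --> 37 / 20 * l - 21 / 20 * l.
    by apply: cvgB; apply: cvgMr.
  move=> /(cvg_unique _ uSSl) lE; have := lE (@norm_hausdorff _ _); lra.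
have : (fun k => spiral_norm (spiral k) (spiral k.+1)) @ \oo
       --> spiral_norm l l.
  apply: cvgD; [apply: cvgB|].
  - by rewrite expr2; apply: cvgM.
  - by apply: cvgM => //; apply: cvgMr.
  - by apply: cvgMr; rewrite expr2; apply: cvgM.
move=> /cvgr_to_ge; have /[swap]/[apply] : \forall k \near \oo,
    1 <= spiral_norm (spiral k) (spiral k.+1).
  by apply: nearW => k; exact: spiral_norm_ge1.
by rewrite l0 /spiral_norm; lra.
Qed.

End Spiral.

(** * The problem and its divergent orbit *)

Section Instance.
Variables (R : realType) (m : nat).

(** The default values extend the three columns by zero columns. *)
Definition column_entry (j r : nat) : nat :=
  nth 0%N (nth [::] [:: [:: 0; 1; 3]; [:: 1; 0; 3]; [:: 1; 1; 2]] j)%N r.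

Definition spiral_problem : problem R m :=
  @Problem R m (fun=> 1%N) 3
    (fun i v => if (i < 3)%N then 0 else v 0 0 ^+ 2)
    (fun i => \col_r (column_entry i r)%:R)
    (fun=> setT) 0.

(** The coefficients come from an eigenvector (x_1, x_2, x_3, y), where y is the
    multiplier divided by beta, for a root l of l^2 - (37/20) l + 21/20.  Cleared
    of denominators it is (15, 21 - 30 l, 35 l - 42) in the blocks and
    (84 - 85 l, 5 l - 42, 40 l - 21) in y; since the orbit of l^k through this
    eigenvector obeys the recurrence of [spiral], replacing 1 and l by u_k and
    u_(k+1) gives a real orbit. *)
Definition spiral_block (k j : nat) : R :=
  nth 0 [:: 15 * spiral R k;
            21 * spiral R k - 30 * spiral R k.+1;
            35 * spiral R k.+1 - 42 * spiral R k] j.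

Definition spiral_primal (k : nat) : primal spiral_problem :=
  fun i => const_mx (spiral_block k i).

Definition spiral_multiplier (beta : R) (k : nat) : multiplier spiral_problem :=
  beta *: \col_r nth 0 [:: 84 * spiral R k - 85 * spiral R k.+1;
                           5 * spiral R k.+1 - 42 * spiral R k;
                           40 * spiral R k.+1 - 21 * spiral R k] r.

Hypothesis hm : (4 <= m)%N.

Lemma sum_first3 (f : nat -> R) : (forall j, (3 <= j)%N -> f j = 0) ->
  \sum_(j < m) f j = f 0%N + f 1%N + f 2%N.
Proof.
move=> f0; rewrite -(big_mkord xpredT f) (@big_cat_nat _ _ _ 3)//= ?(ltnW hm)//.
rewrite [X in _ + X]big_nat_cond [X in _ + X]big1 ?addr0; last first.
  by move=> j /andP[/andP[/f0]].
by rewrite !big_nat_recr//= big_geq// add0r.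
Qed.

Lemma residual_spiral_problem (x : primal spiral_problem) (s : nat -> R) :
  (forall j, x j 0 0 = s j) ->
  residual x = \col_r \sum_(j < 3) (column_entry j r)%:R * s j.
Proof.
move=> xs; apply/matrixP => r c; rewrite (ord1 c) !mxE subr0 summxE.
pose f j := (column_entry j r)%:R * s j.
rewrite (eq_bigr (fun j : 'I_m => f j)); last first.
  by move=> j _; rewrite !mxE big_ord1 !mxE xs.
rewrite sum_first3; first by rewrite !big_ord_recr big_ord0 /= add0r.
move=> j j3; rewrite /f /column_entry [nth [::] _ _]nth_default//.
by rewrite nth_nil mul0r.
Qed.

Lemma admissible_spiral_problem : admissible spiral_problem.
Proof.
split=> //.
- move=> i; rewrite /theta /=; case: (i < 3)%N.
    exact: closed_proper_convex_zero.
  exact: closed_proper_convex_square.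
- move=> i; split; [by exists 0|exact: closedT|].
  by move=> x y t _ _; rewrite inE.
exists (fun=> 0); split=> [|x _].
  split=> //; rewrite /residual big1 ?subr0// => i _.
  by rewrite mulmx0.
rewrite /objective big1; last first.
  by move=> i _ /=; case: ifP => // _; rewrite mxE expr0n.
by apply: sumr_ge0 => i _ /=; case: ifP => // _; exact: sqr_ge0.
Qed.

Lemma strongly_convex_spiral_problem (i : 'I_m) :
  i \in [set i : 'I_m | (3 <= i)%N]%SET
  <-> strongly_convex (@theta R m spiral_problem i).
Proof.
rewrite inE /theta /=; case: (leqP 3 i) => _; split=> //=.
  by move=> _; exact: strongly_convex_square.
by move=> /not_strongly_convex_zero.
Qed.

Lemma card_strongly_convex : #|[set i : 'I_m | (3 <= i)%N]%SET| = (m - 3)%N.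
Proof.
have := cardsC [set i : 'I_m | (i < 3)%N]%SET.
rewrite card_ord (_ : ~: _ = [set i : 'I_m | (3 <= i)%N])%SET; last first.
  by apply/setP => i; rewrite !inE -leqNgt.
rewrite cardsE -sum1_card.
rewrite -(big_ord_widen m (fun=> 1%N) (ltnW hm)) sum1_card card_ord.
exact: (canRL (addKn 3)).
Qed.

Lemma eADMM_spiral (beta : R) : 0 < beta ->
  eADMM beta (spiral_primal 0) (spiral_multiplier beta 0)
    spiral_primal (spiral_multiplier beta).
Proof.
move=> beta0; split=> // [k i|k]; last first.
  rewrite (@residual_spiral_problem _ (spiral_block k.+1)); last first.
    by move=> j; rewrite mxE.
  apply/matrixP => r c; rewrite !mxE !big_ord_recr big_ord0.
  rewrite /spiral_block /column_entry /= spiralSS.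
  by case: r => -[|[|[|//]]] /= _; field.
apply: argmin_block => // u uv.
have uv0 : 0 < (u 0 0 - spiral_block k.+1 i) ^+ 2.
  rewrite lt_neqAle sqr_ge0 andbT eq_sym sqrf_eq0 subr_eq0.
  apply: contra uv => /eqP e; apply/eqP/matrixP => a b.
  by rewrite (ord1 a) (ord1 b) mxE.
(* In the subproblem of block i, at its solution, the blocks up to i are new. *)
rewrite (@residual_spiral_problem _
    (fun j => if (j <= i)%N then spiral_block k.+1 j else spiral_block k j));
  last first.
  move=> j; rewrite /gauss_seidel; case: eqtype.dfwithP => [|{}j ij].
    by rewrite leqnn mxE.
  move: ij; rewrite -(inj_eq val_inj) /= eq_sym => /negPf ij.
  by rewrite [(j <= i)%N]leq_eqVlt ij /=; case: ifP => _; rewrite mxE.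
have -> : coefA spiral_problem i *m (u - spiral_primal k.+1 i)
  = \col_r ((column_entry i r)%:R * (u 0 0 - spiral_block k.+1 i)).
  by apply/matrixP => a b; rewrite (ord1 b) !mxE big_ord1 !mxE.
rewrite enorm_sqr /dotv !big_ord_recr !big_ord0 /= !mxE /=.
rewrite !big_ord_recr !big_ord0 /=.
have [i3|i3] := leqP 3 i.
  move: uv0; rewrite /column_entry ![nth [::] _ i]nth_default// !nth_nil.
  rewrite /spiral_block [nth _ _ i]nth_default//.
  by rewrite !(subr0, mul0r, mulr0, addr0) expr0n subr0.
have : 0 < beta * (u 0 0 - spiral_block k.+1 i) ^+ 2 by rewrite mulr_gt0.
move: (u 0 0 - _) => d; rewrite subrr.
(* With d the displacement of the block, the increment is c * beta * d^2, where
   c is half the squared length of the column: 5, 5 and 3. *)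
case: i i3 {u uv uv0} => -[|[|[|//]]] im /= _;
  rewrite /column_entry /spiral_block /= ?spiralSS => d0.
all: lra.
Qed.

End Instance.

Theorem theorem6p2 (R : realType) (m : nat) (hm : (4 <= m)%N)
    (beta : R) (hbeta : 0 < beta) :
  exists P : problem R m,
    [/\ admissible P,
        exists S : {set 'I_m}, #|S| = (m - 3)%N /\
          forall i, i \in S <-> strongly_convex (@theta R m P i) &
        exists (x0 : primal P) (z0 : multiplier P)
               (x : nat -> primal P) (z : nat -> multiplier P),
          eADMM beta x0 z0 x z /\ ~ cvgn (iterates x z)].
Proof.
exists (spiral_problem R m); split.
- exact: admissible_spiral_problem.
- exists [set i : 'I_m | (3 <= i)%N]%SET; split.
    exact: card_strongly_convex.
  exact: strongly_convex_spiral_problem.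
exists (@spiral_primal R m 0), (@spiral_multiplier R m beta 0),
  (@spiral_primal R m), (@spiral_multiplier R m beta).
split; first exact: eADMM_spiral.
move=> /cvg_ex[/= w cw]; apply: (@spiral_not_cvg R).
pose i0 : 'I_m := Ordinal (leq_trans (isT : 0 < 4)%N hm).
(* It suffices to follow the first block, which is 15 u_k. *)
pose w0 (v : 'cV[R]_(\sum_i Defs.dim (spiral_problem R m) i
                       + nrows (spiral_problem R m))) :=
  v (lshift _ (tagnat.Rank i0 0)) 0.
have first_block k : spiral R k.+1 =
    15^-1 * w0 (iterates (@spiral_primal R m) (@spiral_multiplier R m beta) k).
  have -> v : w0 v = submxcol (usubmx v) i0 0 0 by rewrite !mxE.
  by rewrite /iterates col_mxKu mxcolK mxE /spiral_block /=; field.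
apply/cvg_ex; exists (15^-1 * w0 w).
rewrite -cvg_shiftS (funext first_block); apply: cvgMr.
exact: (cvg_comp _ _ cw (@coord_continuous R _ _ _ _ w)).
Qed.
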